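(* For every convex point set $P$ with $n$ points in the plane, there exists an increasing-chord geometric graph $G(P,S)$ with vertex set $P$ such that $|S|\in O(n\log n)$.
   Context: A convex point set is a finite point set in the plane in which no point is a convex combination of the others. A geometric graph $(P,S)$ consists of the point set $P$ and a set $S$ of straight-line segments (edges) between points of $P$. For points $p,q$, $|\overline{pq}|$ is the Euclidean length of $\overline{pq}$. A geometric path $(v_1,\dots,v_n)$ is self-approaching from $v_1$ to $v_n$ if for every three distinct points $a,b,c$ appearing in this order along the path from $v_1$ to $v_n$ (possibly interior to edges) we have $|\overline{bc}|<|\overline{ac}|$. A geometric graph is increasing-chord if for every pair of vertices $u,v$ it contains a path between $u$ and $v$ that is self-approaching both from $u$ to $v$ and from $v$ to $u$. No Steiner points are allowed: the vertex set is exactly $P$. *)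

(* Defs.v *)
From Stdlib Require Import Reals Lra List.
Import ListNotations.
Open Scope R_scope.

Definition point : Type := (R * R)%type.

Definition dist (p q : point) : R :=
  sqrt ((fst p - fst q) ^ 2 + (snd p - snd q) ^ 2).

Fixpoint sum_R (l : list R) : R :=
  match l with [] => 0 | x :: l' => x + sum_R l' end.

Fixpoint wsum (w : list R) (l : list point) : point :=
  match w, l with
  | a :: w', q :: l' => let s := wsum w' l' in (a * fst q + fst s, a * snd q + snd s)
  | _, _ => (0, 0)
  end.

Definition convex_comb_of_others (P : list point) (p : point) : Prop :=
  exists (l : list point) (w : list R),
    Forall (fun q => In q P /\ q <> p) l /\
    length w = length l /\
    Forall (fun a => 0 <= a) w /\
    sum_R w = 1 /\
    wsum w l = p.

Definition convex_point_set (P : list point) : Prop :=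
  NoDup P /\ forall p, In p P -> ~ convex_comb_of_others P p.

Definition has_edge (S : list (point * point)) (p q : point) : Prop :=
  In (p, q) S \/ In (q, p) S.

Definition geometric_graph (P : list point) (S : list (point * point)) : Prop :=
  forall p q, In (p, q) S -> In p P /\ In q P /\ p <> q.

Fixpoint is_path (S : list (point * point)) (vs : list point) : Prop :=
  match vs with
  | p :: ((q :: _) as vs') => has_edge S p q /\ is_path S vs'
  | _ => True
  end.

Definition path_point (vs : list point) (i : nat) (t : R) : point :=
  let a := nth i vs (0, 0) in
  let b := nth (S i) vs (0, 0) in
  (fst a + t * (fst b - fst a), snd a + t * (snd b - snd a)).

Definition valid_pos (vs : list point) (i : nat) (t : R) : Prop :=
  (S i < length vs)%nat /\ 0 <= t <= 1.

Definition pos_le (i : nat) (s : R) (j : nat) (t : R) : Prop :=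
  (i < j)%nat \/ (i = j /\ s <= t).

Definition self_approaching (vs : list point) : Prop :=
  forall (i j k : nat) (s t u : R),
    valid_pos vs i s -> valid_pos vs j t -> valid_pos vs k u ->
    pos_le i s j t -> pos_le j t k u ->
    let a := path_point vs i s in
    let b := path_point vs j t in
    let c := path_point vs k u in
    a <> b -> b <> c -> a <> c ->
    dist b c < dist a c.

Definition increasing_chord (P : list point) (S : list (point * point)) : Prop :=
  forall u v, In u P -> In v P -> u <> v ->
    exists vs : list point,
      hd (0, 0) vs = u /\ last vs (0, 0) = v /\ vs <> [] /\
      Forall (fun x => In x P) vs /\
      is_path S vs /\
      self_approaching vs /\ self_approaching (rev vs).

(* Main.v *)
(* A path that is monotone in both coordinates of some orthogonal frame is
   self-approaching in both directions.  Every point p of a convex set P has an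
   outer normal w p at which p is strictly extreme.  For a direction d, let U be
   the points whose normals satisfy d . w p >= 0: seen from p in U, all points
   higher in direction d lie on the same side, determined by the sideways sign of
   w p.  Hence descending from a point of U through the points of one sign class
   is monotone in both coordinates, and linearly many edges join all pairs of U.
   Applied to d and -d this joins all pairs not strictly separated by the line
   orthogonal to d in the space of normals.  Taking first the horizontal line,
   and then lines through the median normal of the upper class A, the remaining
   pairs of A x B split into A1 x B1 and A2 x B2 with |A1|, |A2| <= |A| / 2 and
   B1, B2 disjoint, so each of the log n levels costs O(n) edges. *)

Require Import Defs.
From Stdlib Require Import Reals List.
From Stdlib Require Import Lra Lia Classical ClassicalEpsilon.
From Stdlib Require Import Permutation Sorted Relations.
Import ListNotations.
Open Scope R_scope.

(** * Orthogonal frames and chains monotone in a frame *)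

Definition dot (a p : point) : R := fst a * fst p + snd a * snd p.

Definition perp (a : point) : point := (- snd a, fst a).

Definition vec (p q : point) : point := (fst q - fst p, snd q - snd p).

Definition step (e p q : point) : Prop :=
  dot e p <= dot e q /\ dot (perp e) p <= dot (perp e) q.

Definition link (P : list point) (S : list (point * point)) (e p q : point) : Prop :=
  In p P /\ In q P /\ p <> q /\ has_edge S p q /\ step e p q.

(** One frame serves the whole chain: chains monotone in different frames need not compose to a
    monotone path, so this relation is symmetric but in general not transitive. *)
Definition joined (P : list point) (S : list (point * point)) (u v : point) : Prop :=
  exists e, e <> (0, 0) /\ clos_refl_trans point (link P S e) u v.

Lemma norm_pos (e : point) : e <> (0, 0) -> 0 < dot e e.
Proof.
  destruct e as [x y]; unfold dot; simpl; intros H.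
  destruct (Req_dec x 0) as [->|Hx]; [|nra].
  destruct (Req_dec y 0) as [->|Hy]; [now elim H|nra].
Qed.

Lemma vec_neq0 (p q : point) : p <> q -> vec p q <> (0, 0).
Proof.
  destruct p, q; intros Hne H; apply Hne; injection H as H1 H2; simpl in *.
  f_equal; lra.
Qed.

(** * Monotone paths *)

Lemma path_point_dot (e : point) (vs : list point) i t :
  dot e (path_point vs i t) =
  dot e (nth i vs (0, 0)) +
  t * (dot e (nth (S i) vs (0, 0)) - dot e (nth i vs (0, 0))).
Proof. unfold dot, path_point; simpl; ring. Qed.

Lemma path_point_mono (e : point) (vs : list point) i s j t :
  (forall k, (S k < length vs)%nat ->
     dot e (nth k vs (0, 0)) <= dot e (nth (S k) vs (0, 0))) ->
  valid_pos vs i s -> valid_pos vs j t -> pos_le i s j t ->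
  dot e (path_point vs i s) <= dot e (path_point vs j t).
Proof.
  intros Hm [Hi Hs] [Hj Ht] Hle.
  assert (Hmono : forall m k, (m <= k < length vs)%nat ->
            dot e (nth m vs (0, 0)) <= dot e (nth k vs (0, 0))).
  { intros m k; induction k as [|k IH]; intros Hk.
    - replace m with O by lia; lra.
    - destruct (Nat.eq_dec m (S k)) as [->|Hne]; [lra|].
      apply Rle_trans with (dot e (nth k vs (0, 0))); [apply IH; lia|apply Hm; lia]. }
  rewrite !path_point_dot.
  pose proof (Hm i Hi) as Hi'; pose proof (Hm j Hj) as Hj'.
  destruct Hle as [Hlt|[-> Hst]].
  - pose proof (Hmono (S i) j ltac:(lia)) as Hij.
    set (x := dot e (nth i vs _)) in *; set (x' := dot e (nth (S i) vs _)) in *.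
    set (y := dot e (nth j vs _)) in *; set (y' := dot e (nth (S j) vs _)) in *.
    clearbody x x' y y'; clear Hm Hmono; nra.
  - apply Rplus_le_compat_l, Rmult_le_compat_r; lra.
Qed.

(** In the frame of [e] the vectors from [a] to [b] and from [b] to [c] have nonnegative
    coordinates, so the squared length of their sum is at least the sum of their squared lengths,
    and the first is nonzero. As [e] need not be a unit vector, all is scaled by [dot e e]. *)
Lemma dist_lt_step (e a b c : point) :
  e <> (0, 0) -> a <> b -> step e a b -> step e b c -> Defs.dist b c < Defs.dist a c.
Proof.
  intros He Hab [H1 H2] [H3 H4].
  pose proof (norm_pos e He) as Hn.
  unfold Defs.dist; apply sqrt_lt_1_alt; split.
  { apply Rplus_le_le_0_compat; apply pow2_ge_0. }
  apply Rmult_lt_reg_l with (dot e e); [exact Hn|].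
  assert (Hid : forall p q : point,
    dot e e * ((fst p - fst q) ^ 2 + (snd p - snd q) ^ 2) =
    (dot e q - dot e p) ^ 2 + (dot (perp e) q - dot (perp e) p) ^ 2).
  { intros p q; unfold dot, perp; simpl; ring. }
  assert (Hpos : 0 < dot e e * ((fst a - fst b) ^ 2 + (snd a - snd b) ^ 2)).
  { apply Rmult_lt_0_compat; [exact Hn|].
    pose proof (norm_pos _ (vec_neq0 a b Hab)) as Hv.
    unfold dot, vec in Hv; simpl in *; lra. }
  rewrite !Hid in *; nra.
Qed.

Lemma self_approaching_step (e : point) (vs : list point) :
  e <> (0, 0) ->
  (forall i, (S i < length vs)%nat -> step e (nth i vs (0, 0)) (nth (S i) vs (0, 0))) ->
  self_approaching vs.
Proof.
  intros He Hs i j k s t u Vi Vj Vk Hij Hjk a b c Hab _ _.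
  apply dist_lt_step with e; try assumption; split;
    apply path_point_mono; auto; intros m Hm; apply (Hs m Hm).
Qed.

Lemma step_opp e p q : step e p q -> step (- fst e, - snd e) q p.
Proof. unfold step, dot, perp; simpl; lra. Qed.

Lemma opp_neq0 (e : point) : e <> (0, 0) -> (- fst e, - snd e) <> (0, 0).
Proof.
  intros He H; apply He; destruct e as [x y]; injection H as H1 H2; simpl in *.
  f_equal; lra.
Qed.

Lemma self_approaching_rev (e : point) (vs : list point) :
  e <> (0, 0) ->
  (forall i, (S i < length vs)%nat -> step e (nth i vs (0, 0)) (nth (S i) vs (0, 0))) ->
  self_approaching (rev vs).
Proof.
  intros He Hs.
  apply self_approaching_step with (- fst e, - snd e); [now apply opp_neq0|].
  intros i Hi; rewrite length_rev in Hi.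
  rewrite !rev_nth by lia.
  apply step_opp.
  (* Edge [i] of [rev vs] is edge [length vs - S (S i)] of [vs] traversed backwards, hence a step in
     the frame of [-e]. *)
  replace (length vs - S i)%nat with (S (length vs - S (S i))) by lia.
  apply Hs; lia.
Qed.

Lemma joined_sym P S u v : joined P S u v -> joined P S v u.
Proof.
  intros [e [He H]]; exists (- fst e, - snd e); split; [now apply opp_neq0|].
  induction H as [p q (Hp & Hq & Hpq & Hed & Hst)| |]; [|apply rt_refl|eapply rt_trans; eauto].
  apply rt_step; repeat split; auto;
    [destruct Hed; [right|left]; assumption|..]; now apply step_opp.
Qed.

Lemma joined_incl P S S' u v : incl S S' -> joined P S u v -> joined P S' u v.
Proof.
  intros Hi [e [He H]]; exists e; split; [exact He|].
  induction H as [p q (Hp & Hq & Hpq & Hed & Hst)| |]; [|apply rt_refl|eapply rt_trans; eauto].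
  apply rt_step; repeat split; auto; try apply Hst.
  destruct Hed; [left|right]; auto.
Qed.

Lemma joined_path P S u v :
  In u P -> joined P S u v ->
  exists vs : list point,
    hd (0, 0) vs = u /\ last vs (0, 0) = v /\ vs <> [] /\
    Forall (fun x => In x P) vs /\ is_path S vs /\
    self_approaching vs /\ self_approaching (rev vs).
Proof.
  intros Hu [e [He H]].
  cut (exists vs, hd (0, 0) vs = u /\ last vs (0, 0) = v /\ vs <> [] /\
    Forall (fun x => In x P) vs /\ is_path S vs /\
    forall i, (Datatypes.S i < length vs)%nat ->
      step e (nth i vs (0, 0)) (nth (Datatypes.S i) vs (0, 0))).
  { intros (vs & H1 & H2 & H3 & H4 & H5 & H6); exists vs.
    repeat split; auto;
      [apply self_approaching_step with e|apply self_approaching_rev with e]; auto. }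
  apply clos_rt_rt1n in H; induction H as [u|u q v (_ & Hq & _ & Hed & Hst) _ IH].
  - exists [u]; simpl; repeat split; auto; try discriminate; lia.
  - destruct (IH Hq) as (vs & H1 & H2 & H3 & H4 & H5 & H6).
    destruct vs as [|q' vs]; [now elim H3|simpl in H1; subst q'].
    exists (u :: q :: vs); repeat split; auto; try discriminate.
    + simpl in H; destruct i; [apply Hst|apply H6; simpl; lia].
    + simpl in H; destruct i; [apply Hst|apply H6; simpl; lia].
Qed.

(** * Linear-size graphs on one-sided sets *)

Lemma sorted_permutation {A : Type} (f : A -> R) (l : list A) :
  exists l', Permutation l l' /\ StronglySorted (fun p q => f p <= f q) l'.
Proof.
  induction l as [|a l (l' & Hp & Hs)]; [exists []; split; constructor|].
  cut (exists l'', Permutation (a :: l') l'' /\ StronglySorted (fun p q => f p <= f q) l'').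
  { intros (l'' & Hp' & Hs'); exists l''; split; [|exact Hs'].
    now rewrite Hp. }
  clear l Hp; induction Hs as [|b l' Hs (l'' & Hp' & Hs') Hb].
  - exists [a]; repeat constructor.
  - destruct (Rle_dec (f a) (f b)) as [Hab|Hab].
    + exists (a :: b :: l'); split; [reflexivity|].
      constructor; [now constructor|constructor; [exact Hab|]].
      eapply Forall_impl; [|exact Hb]; simpl; intros; lra.
    + exists (b :: l''); split.
      * rewrite perm_swap; now constructor.
      * constructor; [exact Hs'|].
        apply (Permutation_Forall Hp'); constructor; [lra|exact Hb].
Qed.

(* Each [z] gets one edge to the highest point of [T] that is not above it;
   iterating this descent from [z] meets every lower point of [T]. *)
Lemma climb (f : point -> R) (T D : list point) :
  exists S : list (point * point), (length S <= length T + length D)%nat /\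
    forall t z, In t T -> In z D -> t <> z -> f t <= f z ->
      clos_refl_trans point
        (fun p q => has_edge S p q /\ In p T /\ In q (T ++ D) /\ p <> q /\ f p <= f q) t z.
Proof.
  (* Sorting by [- f] puts the highest point of [T] first, where the induction removes it. *)
  destruct (sorted_permutation (fun p => - f p) T) as (T' & Hperm & Hs).
  cut (exists S : list (point * point), (length S <= length T' + length D)%nat /\
    forall t z, In t T' -> In z D -> t <> z -> f t <= f z ->
      clos_refl_trans point
        (fun p q => has_edge S p q /\ In p T' /\ In q (T' ++ D) /\ p <> q /\ f p <= f q) t z).
  { intros (S & HS & Hc); exists S; split; [now rewrite (Permutation_length Hperm)|].
    intros t z Ht Hz Hne Hle.
    assert (Hc' := Hc t z (Permutation_in _ Hperm Ht) Hz Hne Hle).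
    clear - Hperm Hc'.
    induction Hc' as [p q (H1 & H2 & H3 & H4)| |]; [|apply rt_refl|eapply rt_trans; eauto].
    apply rt_step; repeat split; try tauto; try (eapply Permutation_in; [symmetry|]; eassumption).
    eapply Permutation_in; [|exact H3]; apply Permutation_app_tail; now symmetry. }
  clear T Hperm; revert D; induction Hs as [|t1 T Hs IH Hall]; intros D.
  { exists []; split; [simpl; lia|intros t z []]. }
  set (below := fun z => if Rlt_dec (f z) (f t1) then true else false).
  (* Targets not below [t1] get their edge to [t1]; the lower ones are passed on, together with [t1]
     as a new target. So each entry of [T] and [D] is charged at most one edge. *)
  destruct (IH (t1 :: filter below D)) as (S & HS & Hc).
  exists (S ++ map (pair t1) (filter (fun z => negb (below z)) D)); split.
  { rewrite length_app, length_map; simpl in *.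
    pose proof (filter_length below D); lia. }
  assert (Htop : forall z, In z D -> t1 <> z -> f t1 <= f z ->
    clos_refl_trans point (fun p q =>
      has_edge (S ++ map (pair t1) (filter (fun z => negb (below z)) D)) p q /\
      In p (t1 :: T) /\ In q ((t1 :: T) ++ D) /\ p <> q /\ f p <= f q) t1 z).
  { intros z Hz Hne Hle; apply rt_step; repeat split; auto; [|now left|].
    - left; apply in_or_app; right; apply in_map, filter_In; split; [exact Hz|].
      unfold below; destruct (Rlt_dec (f z) (f t1)); [lra|reflexivity].
    - right; apply in_or_app; now right. }
  assert (Hrec : forall t z, In t T -> In z (t1 :: filter below D) -> t <> z -> f t <= f z ->
    clos_refl_trans point (fun p q =>
      has_edge (S ++ map (pair t1) (filter (fun z => negb (below z)) D)) p q /\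
      In p (t1 :: T) /\ In q ((t1 :: T) ++ D) /\ p <> q /\ f p <= f q) t z).
  { intros t z Ht Hz Hne Hle; specialize (Hc t z Ht Hz Hne Hle).
    clear - Hc.
    induction Hc as [p q (H1 & H2 & H3 & H4)| |]; [|apply rt_refl|eapply rt_trans; eauto].
    apply rt_step; repeat split; try tauto.
    - destruct H1; [left|right]; apply in_or_app; now left.
    - now right.
    - apply in_app_or in H3; destruct H3 as [H3|[<-|H3]].
      + right; apply in_or_app; now left.
      + now left.
      + apply filter_In in H3; right; apply in_or_app; now right. }
  intros t z [<-|Ht] Hz Hne Hle; [now apply Htop|].
  destruct (Rlt_dec (f z) (f t1)) as [Hlt|Hge].
  - apply Hrec; auto; right; apply filter_In; split; [exact Hz|].
    unfold below; now destruct (Rlt_dec (f z) (f t1)).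
  - destruct (classic (t = t1)) as [->|Ht1]; [apply Htop; auto; lra|].
    (* A chain from a lower [t] to a target not below [t1] passes through [t1]. *)
    apply rt_trans with t1.
    + apply Hrec; auto; [now left|].
      rewrite Forall_forall in Hall; specialize (Hall t Ht); simpl in Hall; lra.
    + destruct (classic (t1 = z)) as [<-|Hz1]; [apply rt_refl|apply Htop; auto; lra].
Qed.

Definition supports (P : list point) (w : point -> point) : Prop :=
  forall p q, In p P -> In q P -> q <> p -> dot (w p) q < dot (w p) p.

(** Expand the product of [w p] and [q - p] in the frame of [d]: the whole is negative and the term
    along [d] is nonnegative, so the sideways term is negative. *)
Lemma support_turn P w d p q :
  supports P w -> In p P -> In q P -> p <> q -> d <> (0, 0) ->
  0 <= dot d (w p) -> dot d p <= dot d q ->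
  dot (perp d) (w p) * (dot (perp d) q - dot (perp d) p) < 0.
Proof.
  intros Hw Hp Hq Hne Hd H1 H2.
  specialize (Hw p q Hp Hq (not_eq_sym Hne)).
  pose proof (norm_pos d Hd) as Hn.
  assert (Hid : dot d d * (dot (w p) q - dot (w p) p) =
    dot d (w p) * (dot d q - dot d p) +
    dot (perp d) (w p) * (dot (perp d) q - dot (perp d) p)).
  { unfold dot, perp; simpl; ring. }
  nra.
Qed.

Lemma one_sided_graph P w d (U : list point) :
  supports P w -> d <> (0, 0) -> incl U P ->
  (forall p, In p U -> 0 <= dot d (w p)) ->
  exists S : list (point * point), (length S <= 4 * length U)%nat /\
    forall u v, In u U -> In v U -> u <> v -> joined P S u v.
Proof.
  intros Hw Hd HU Hpos.
  set (left_pt := fun p => if Rle_dec 0 (dot (perp d) (w p)) then true else false).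
  (* Only the lower end of each link must belong to the class [side], so the top end [v] of the
     chain is arbitrary in [U]. *)
  assert (Hclimb : forall side e, e <> (0, 0) ->
    (forall p q, In p U -> In q U -> p <> q -> side p = true ->
       dot d p <= dot d q -> step e p q) ->
    exists S : list (point * point), (length S <= length (filter side U) + length U)%nat /\
      forall u v, In u U -> In v U -> u <> v -> side u = true -> dot d u <= dot d v ->
        joined P S u v).
  { intros side e He Hstep.
    destruct (climb (dot d) (filter side U) U) as (S & HS & Hc).
    exists S; split; [exact HS|].
    intros u v Hu Hv Hne Hside Hle.
    specialize (Hc u v (proj2 (filter_In _ _ _) (conj Hu Hside)) Hv Hne Hle).
    exists e; split; [exact He|].
    clear - Hc HU Hstep.
    induction Hc as [p q (H1 & H2 & H3 & H4 & H5)| |]; [|apply rt_refl|eapply rt_trans; eauto].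
    apply filter_In in H2; destruct H2 as [H2 H2'].
    assert (Hq : In q U).
    { apply in_app_or in H3; destruct H3 as [H3|H3]; [|exact H3].
      now apply filter_In in H3. }
    apply rt_step; red; auto 10. }
  (* The [perp] of this vector is [d]: its frame is the one in which rising along [d] while falling
     along [perp d] is a step. *)
  destruct (Hclimb left_pt (snd d, - fst d)) as (S1 & HS1 & Hc1).
  { intros H; apply Hd; destruct d as [x y]; simpl in H.
    injection H as H1 H2; f_equal; lra. }
  { intros p q Hp Hq Hne Hleft Hle.
    pose proof (support_turn P w d p q Hw (HU p Hp) (HU q Hq) Hne Hd (Hpos p Hp) Hle) as Ht.
    unfold left_pt in Hleft; destruct (Rle_dec 0 (dot (perp d) (w p))); [|discriminate].
    assert (dot (perp d) q < dot (perp d) p) by nra.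
    unfold step, dot, perp in *; simpl in *; lra. }
  (* In the other class both the [d] and the [perp d] coordinates rise, so the frame of [d] itself
     works. *)
  destruct (Hclimb (fun p => negb (left_pt p)) d Hd) as (S2 & HS2 & Hc2).
  { intros p q Hp Hq Hne Hleft Hle.
    pose proof (support_turn P w d p q Hw (HU p Hp) (HU q Hq) Hne Hd (Hpos p Hp) Hle) as Ht.
    unfold left_pt in Hleft; destruct (Rle_dec 0 (dot (perp d) (w p))); [discriminate|].
    split; [exact Hle|nra]. }
  exists (S1 ++ S2); split.
  { rewrite length_app; pose proof (filter_length left_pt U); lia. }
  assert (Hup : forall u v, In u U -> In v U -> u <> v -> dot d u <= dot d v ->
            joined P (S1 ++ S2) u v).
  { intros u v Hu Hv Hne Hle.
    destruct (left_pt u) eqn:Hleft.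
    - apply joined_incl with S1; [apply incl_appl, incl_refl|auto].
    - apply joined_incl with S2; [apply incl_appr, incl_refl|].
      apply Hc2; auto; now rewrite Hleft. }
  intros u v Hu Hv Hne.
  destruct (Rle_dec (dot d u) (dot d v)) as [Hle|Hgt]; [now apply Hup|].
  apply joined_sym, Hup; auto; lra.
Qed.

(** A nonnegative product puts both normals in one closed half-plane bounded by the line orthogonal
    to [d]; the one-sided graphs for [d] and [-d] cover the two half-planes. *)
Lemma half_planes_graph P w d (Q : list point) :
  supports P w -> d <> (0, 0) -> incl Q P ->
  exists S : list (point * point), (length S <= 8 * length Q)%nat /\
    forall u v, In u Q -> In v Q -> u <> v ->
      0 <= dot d (w u) * dot d (w v) -> joined P S u v.
Proof.
  intros Hw Hd HQ.
  assert (Hside : forall d', d' <> (0, 0) ->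
    exists S : list (point * point), (length S <= 4 * length Q)%nat /\
      forall u v, In u Q -> In v Q -> u <> v ->
        0 <= dot d' (w u) -> 0 <= dot d' (w v) -> joined P S u v).
  { intros d' Hd'.
    set (up := fun p => if Rle_dec 0 (dot d' (w p)) then true else false).
    assert (Hup : forall p, In p (filter up Q) <-> In p Q /\ 0 <= dot d' (w p)).
    { intros p; rewrite filter_In; unfold up.
      destruct (Rle_dec 0 (dot d' (w p))); intuition discriminate. }
    destruct (one_sided_graph P w d' (filter up Q)) as (S & HS & Hj); auto.
    - intros p Hp; apply HQ; now apply Hup.
    - intros p Hp; now apply Hup.
    - exists S; split; [pose proof (filter_length_le up Q); lia|].
      intros u v Hu Hv Hne Hu' Hv'; apply Hj; auto; now apply Hup. }
  destruct (Hside d Hd) as (S1 & HS1 & Hj1).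
  destruct (Hside _ (opp_neq0 d Hd)) as (S2 & HS2 & Hj2).
  assert (Hopp : forall p, dot (- fst d, - snd d) p = - dot d p).
  { intros p; unfold dot; simpl; ring. }
  exists (S1 ++ S2); split; [rewrite length_app; lia|].
  intros u v Hu Hv Hne Huv.
  assert (Hcase : 0 <= dot d (w u) /\ 0 <= dot d (w v) \/
                  dot d (w u) <= 0 /\ dot d (w v) <= 0).
  { destruct (Rtotal_order (dot d (w u)) 0) as [H|[H|H]],
      (Rtotal_order (dot d (w v)) 0) as [H'|[H'|H']];
      try (left; lra); try (right; lra); exfalso; nra. }
  destruct Hcase as [[H1 H2]|[H1 H2]].
  - apply joined_incl with S1; [apply incl_appl, incl_refl|auto].
  - apply joined_incl with S2; [apply incl_appr, incl_refl|].
    apply Hj2; auto; rewrite Hopp; lra.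
Qed.

(** * Divide and conquer *)

Lemma StronglySorted_split {T : Type} (rel : T -> T -> Prop) l1 m l2 :
  StronglySorted rel (l1 ++ m :: l2) ->
  StronglySorted rel l1 /\ Forall (fun x => rel x m) l1 /\
  Forall (rel m) l2 /\ StronglySorted rel l2.
Proof.
  induction l1 as [|x l1 IH]; simpl; intros H; inversion_clear H as [|? ? Hs Hall].
  - repeat split; auto; constructor.
  - destruct (IH Hs) as (H1 & H2 & H3 & H4).
    apply Forall_app in Hall; destruct Hall as [Hall1 Hall2].
    inversion_clear Hall2; repeat split; auto; constructor; auto.
Qed.

(* The normals in [A] point into the upper half plane, so a line through the
   origin along the median normal halves [A]; of the pairs it separates, each
   point of [B] only occurs with one half of [A]. *)
Lemma bipartite_graph P w D (A B : list point) :
  supports P w -> incl A P -> incl B P ->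
  (length A < 2 ^ D)%nat ->
  (forall p, In p A -> 0 < snd (w p)) ->
  StronglySorted (fun p q => fst (w p) / snd (w p) <= fst (w q) / snd (w q)) A ->
  exists S : list (point * point), (length S <= 8 * D * (length A + length B))%nat /\
    forall u v, In u A -> In v B -> u <> v -> joined P S u v.
Proof.
  intros Hw; revert A B; induction D as [|D IH]; intros A B HA HB Hlen Hpos Hs.
  { destruct A; simpl in Hlen; [|lia]. exists []; split; [simpl; lia|intros u v []]. }
  destruct A as [|a0 A0] eqn:HA0; [exists []; split; [simpl; lia|intros u v []]|].
  rewrite <- HA0 in *.
  assert (Hsplit : exists A1 m A2, A = A1 ++ m :: A2 /\
            (length A1 < 2 ^ D)%nat /\ (length A2 < 2 ^ D)%nat).
  { assert (Hhalf : (length A / 2 < length A)%nat)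
      by (apply Nat.div_lt; [rewrite HA0; simpl; lia|lia]).
    destruct (nth_split A (0, 0) Hhalf) as (A1 & A2 & Heq & Hl1).
    exists A1, (nth (length A / 2) A (0, 0)), A2; split; [exact Heq|].
    assert (Hl := f_equal (@length point) Heq).
    rewrite length_app in Hl; cbn [length] in Hl.
    cbn [Nat.pow] in Hlen.
    pose proof (Nat.div_mod_eq (length A) 2).
    pose proof (Nat.mod_upper_bound (length A) 2 ltac:(lia)); lia. }
  clear a0 A0 HA0; destruct Hsplit as (A1 & m & A2 & -> & Hl1 & Hl2).
  (* Orthogonal to the median normal. Since second coordinates are positive on [A], the sign of
     [dot d (w p)] there compares the sorting ratios of [p] and [m]. *)
  set (d := (snd (w m), - fst (w m))).
  assert (Hm : 0 < snd (w m)) by (apply Hpos, in_elt).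
  assert (Hd : d <> (0, 0)) by (intros H; injection H; lra).
  assert (Hdm : dot d (w m) = 0) by (unfold dot, d; simpl; ring).
  assert (Hkey : forall p q, 0 < snd (w p) -> 0 < snd (w q) ->
    fst (w p) / snd (w p) <= fst (w q) / snd (w q) ->
    fst (w p) * snd (w q) <= fst (w q) * snd (w p)).
  { intros p q Hp Hq Hpq.
    apply Rmult_le_compat_r with (r := snd (w p) * snd (w q)) in Hpq; [|nra].
    replace (fst (w p) / snd (w p) * (snd (w p) * snd (w q)))
      with (fst (w p) * snd (w q)) in Hpq by (field; lra).
    replace (fst (w q) / snd (w q) * (snd (w p) * snd (w q)))
      with (fst (w q) * snd (w p)) in Hpq by (field; lra).
    exact Hpq. }
  assert (HA1 : incl A1 P) by (intros p Hp; apply HA, in_or_app; now left).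
  assert (HA2 : incl A2 P) by (intros p Hp; apply HA, in_or_app; right; now right).
  apply StronglySorted_split in Hs; destruct Hs as (Hs1 & Hall1 & Hall2 & Hs2).
  rewrite Forall_forall in Hall1, Hall2.
  assert (Hd1 : forall p, In p A1 -> dot d (w p) <= 0).
  { intros p Hp; pose proof (Hkey p m) as H; specialize (Hall1 p Hp).
    unfold dot, d; simpl; enough (fst (w p) * snd (w m) <= fst (w m) * snd (w p)) by lra.
    apply H; auto; apply Hpos, in_or_app; now left. }
  assert (Hd2 : forall p, In p A2 -> 0 <= dot d (w p)).
  { intros p Hp; pose proof (Hkey m p) as H; specialize (Hall2 p Hp).
    unfold dot, d; simpl; enough (fst (w m) * snd (w p) <= fst (w p) * snd (w m)) by lra.
    apply H; auto; apply Hpos, in_or_app; right; now right. }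
  (* Uncovered pairs have strictly opposite signs, so partners of [A1] lie in [B1] and partners of
     [A2] in [B2]; [m] itself has sign zero and leaves no such pair. *)
  set (pos := fun p => if Rlt_dec 0 (dot d (w p)) then true else false).
  set (B1 := filter pos B); set (B2 := filter (fun p => negb (pos p)) B).
  destruct (half_planes_graph P w d ((A1 ++ m :: A2) ++ B)) as (S0 & HS0 & Hj0);
    [exact Hw|exact Hd|now apply incl_app|].
  destruct (IH A1 B1) as (S1 & HS1 & Hj1); auto.
  { intros p Hp; apply HB; now apply filter_In in Hp. }
  { intros p Hp; apply Hpos, in_or_app; now left. }
  destruct (IH A2 B2) as (S2 & HS2 & Hj2); auto.
  { intros p Hp; apply HB; now apply filter_In in Hp. }
  { intros p Hp; apply Hpos, in_or_app; right; now right. }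
  exists (S0 ++ S1 ++ S2); split.
  (* This level costs [8 * (length A + length B)], and the two subproblems are disjoint parts of [A]
     and [B]. *)
  { pose proof (filter_length pos B) as HBl; fold B1 B2 in HBl.
    rewrite !length_app in *; cbn [length] in *; nia. }
  intros u v Hu Hv Hne.
  destruct (Rle_dec 0 (dot d (w u) * dot d (w v))) as [Hsame|Hopp].
  { apply joined_incl with S0; [apply incl_appl, incl_refl|].
    apply Hj0; auto; apply in_or_app; now (left + right). }
  apply in_app_or in Hu; destruct Hu as [Hu|[<-|Hu]].
  - apply joined_incl with S1; [apply incl_appr, incl_appl, incl_refl|].
    specialize (Hd1 u Hu); apply Hj1; auto; apply filter_In; split; [exact Hv|].
    unfold pos; destruct (Rlt_dec 0 (dot d (w v))); [reflexivity|nra].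
  - rewrite Hdm in Hopp; lra.
  - apply joined_incl with S2; [apply incl_appr, incl_appr, incl_refl|].
    specialize (Hd2 u Hu); apply Hj2; auto; apply filter_In; split; [exact Hv|].
    unfold pos; destruct (Rlt_dec 0 (dot d (w v))); [nra|reflexivity].
Qed.

(** * Supporting lines *)

Definition cross (a b : point) : R := fst a * snd b - snd a * fst b.

Lemma perturb_neg (f g : point -> R) (l : list point) :
  Forall (fun q => f q < 0) l ->
  exists eps, 0 < eps /\ Forall (fun q => f q + eps * g q < 0) l.
Proof.
  intros Hf.
  (* Allowing every smaller [t] lets the induction take minima of the bounds. *)
  cut (exists eps, 0 < eps /\ forall t, 0 < t <= eps -> Forall (fun q => f q + t * g q < 0) l).
  { intros (eps & Heps & H); exists eps; split; [exact Heps|apply H; lra]. }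
  induction Hf as [|q l Hq _ (eps & Heps & IH)].
  { exists 1; split; [lra|constructor]. }
  assert (Hb : 0 < - f q / (1 + Rabs (g q))).
  { apply Rdiv_lt_0_compat; [lra|pose proof (Rabs_pos (g q)); lra]. }
  exists (Rmin eps (- f q / (1 + Rabs (g q)))); split; [now apply Rmin_glb_lt|].
  intros t [Ht Hle].
  pose proof (Rmin_l eps (- f q / (1 + Rabs (g q)))).
  pose proof (Rmin_r eps (- f q / (1 + Rabs (g q)))).
  constructor; [|apply IH; lra].
  pose proof (Rabs_pos (g q)); pose proof (Rle_abs (g q)).
  assert (Hm : t * (1 + Rabs (g q)) <= - f q).
  { apply Rle_trans with (- f q / (1 + Rabs (g q)) * (1 + Rabs (g q))).
    - apply Rmult_le_compat_r; lra.
    - right; field; lra. }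
  nra.
Qed.

(** Division by [x + y + z] turns the weights into convex ones. The three points may coincide, which
    the degenerate case of [support_exists] uses. *)
Lemma convex_comb_three P p a b c x y z :
  In a P -> In b P -> In c P -> a <> p -> b <> p -> c <> p ->
  0 <= x -> 0 <= y -> 0 <= z -> 0 < x + y + z ->
  x * fst (vec p a) + y * fst (vec p b) + z * fst (vec p c) = 0 ->
  x * snd (vec p a) + y * snd (vec p b) + z * snd (vec p c) = 0 ->
  convex_comb_of_others P p.
Proof.
  intros Ha Hb Hc Hap Hbp Hcp Hx Hy Hz Hs H1 H2.
  exists [a; b; c], [x / (x + y + z); y / (x + y + z); z / (x + y + z)].
  assert (Hdiv : forall r, 0 <= r -> 0 <= r / (x + y + z)).
  { intros r Hr; apply Rmult_le_pos; [exact Hr|left; now apply Rinv_0_lt_compat]. }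
  repeat split; auto.
  - simpl; field; lra.
  - destruct p as [p1 p2]; unfold vec in *; simpl in *; f_equal.
    + apply Rmult_eq_reg_l with (x + y + z); [field_simplify; lra|lra].
    + apply Rmult_eq_reg_l with (x + y + z); [field_simplify; lra|lra].
Qed.

(* Points are added one at a time; when the current normal fails for the new
   point [u], the line through [p] and [u] either has all others strictly on one
   side, and can be rotated slightly about [p], or exhibits [p] as a convex
   combination of [u] and at most two others. *)
Lemma support_exists P p l :
  ~ convex_comb_of_others P p ->
  Forall (fun q => In q P /\ q <> p) l ->
  exists n, Forall (fun q => dot n (vec p q) < 0) l.
Proof.
  intros Hconv; induction 1 as [|u l [Hu Hup] Hl (n & Hn)].
  { exists (0, 0); constructor. }
  assert (Huu : 0 < dot (vec p u) (vec p u)).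
  { now apply norm_pos, vec_neq0, not_eq_sym. }
  (* A normal vanishing on [u] is tilted by a small multiple of [- vec p u], which makes [u] strict
     and keeps the others strict. *)
  assert (Htilt : forall n0, dot n0 (vec p u) = 0 ->
            Forall (fun q => dot n0 (vec p q) < 0) l ->
            exists n, Forall (fun q => dot n (vec p q) < 0) (u :: l)).
  { intros n0 H0 Hn0.
    destruct (perturb_neg _ (fun q => - dot (vec p u) (vec p q)) l Hn0) as (eps & Heps & He).
    assert (Hlin : forall q, dot (fst n0 - eps * fst (vec p u), snd n0 - eps * snd (vec p u)) q
              = dot n0 q + eps * - dot (vec p u) q).
    { intros q; unfold dot; simpl; ring. }
    exists (fst n0 - eps * fst (vec p u), snd n0 - eps * snd (vec p u)).
    constructor; [rewrite Hlin, H0; nra|].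
    eapply Forall_impl; [|exact He]; intros q; now rewrite Hlin. }
  destruct (Rtotal_order (dot n (vec p u)) 0) as [Hlt|[Heq|Hgt]].
  - exists n; now constructor.
  - now apply (Htilt n).
  - rewrite Forall_forall in Hn, Hl.
    destruct (classic (forall q, In q l -> cross (vec p u) (vec p q) < 0)) as [Hneg|Hneg].
    { apply (Htilt (perp (vec p u))); [unfold dot, perp; simpl; ring|].
      apply Forall_forall; intros q Hq; specialize (Hneg q Hq).
      unfold dot, perp, cross in *; simpl in *; lra. }
    destruct (classic (forall q, In q l -> 0 < cross (vec p u) (vec p q))) as [Hpos|Hpos].
    { apply (Htilt (snd (vec p u), - fst (vec p u))); [unfold dot; simpl; ring|].
      apply Forall_forall; intros q Hq; specialize (Hpos q Hq).
      unfold dot, cross in *; simpl in *; lra. }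
    exfalso; apply Hconv.
    apply not_all_ex_not in Hneg; destruct Hneg as (a & Hneg).
    apply not_all_ex_not in Hpos; destruct Hpos as (b & Hpos).
    apply imply_to_and in Hneg; destruct Hneg as [Ha Hca].
    apply imply_to_and in Hpos; destruct Hpos as [Hb Hcb].
    pose proof (Hn a Ha) as Hna; pose proof (Hn b Hb) as Hnb.
    destruct (Hl a Ha) as [HaP Hap]; destruct (Hl b Hb) as [HbP Hbp].
    apply Rnot_lt_le in Hca, Hcb.
    destruct Hca as [Hca|Hca].
    (* Here [a] and [b] lie on opposite closed sides of the line through [p] and [u]. The first two
       weights make the combination of [vec p b] and [vec p a] parallel to [vec p u]; the third,
       found by pairing with [n], cancels it. *)
    + apply (convex_comb_three P p b a u
        (dot n (vec p u) * cross (vec p u) (vec p a))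
        (dot n (vec p u) * - cross (vec p u) (vec p b))
        (cross (vec p u) (vec p b) * dot n (vec p a) -
         cross (vec p u) (vec p a) * dot n (vec p b))); auto;
        try (unfold cross, dot; simpl; ring); nra.
    (* Now [a] is on the line itself, and the signs of [n] place [p] between [a] and [u]. *)
    + apply (convex_comb_three P p a a u (dot n (vec p u)) 0 (- dot n (vec p a))); auto;
        try lra.
      * replace (_ + _ + _) with (- snd n * cross (vec p u) (vec p a))
          by (unfold cross, dot; simpl; ring).
        rewrite <- Hca; ring.
      * replace (_ + _ + _) with (fst n * cross (vec p u) (vec p a))
          by (unfold cross, dot; simpl; ring).
        rewrite <- Hca; ring.
Qed.

Lemma supports_exist P : convex_point_set P -> exists w, supports P w.
Proof.
  intros [_ Hconv].
  (* With [In p P] under the existential, every point has a witness and choice yields a total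
     [w]. *)
  assert (Hex : forall p, exists n, In p P ->
            forall q, In q P -> q <> p -> dot n q < dot n p).
  { intros p; destruct (classic (In p P)) as [Hp|Hp]; [|exists p; tauto].
    assert (Hdec : forall q p : point, {q = p} + {q <> p}).
    { intros q p'; apply excluded_middle_informative. }
    destruct (support_exists P p (filter (fun q => if Hdec q p then false else true) P))
      as (n & Hn); auto.
    - apply Forall_forall; intros q Hq; apply filter_In in Hq; destruct Hq as [Hq Hqp].
      split; [exact Hq|]; now destruct (Hdec q p).
    - exists n; intros _ q Hq Hne; rewrite Forall_forall in Hn.
      enough (dot n (vec p q) < 0) by (unfold dot, vec in *; simpl in *; lra).
      apply Hn, filter_In; split; [exact Hq|]; now destruct (Hdec q p). }
  exists (fun p => proj1_sig (constructive_indefinite_description _ (Hex p))).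
  intros p q Hp Hq Hne.
  now apply (proj2_sig (constructive_indefinite_description _ (Hex p))).
Qed.

(** * The edge bound *)

Lemma joined_graph P w D :
  supports P w -> (length P < 2 ^ D)%nat ->
  exists S : list (point * point), (length S <= 8 * (D + 1) * length P)%nat /\
    forall u v, In u P -> In v P -> u <> v -> joined P S u v.
Proof.
  intros Hw HD.
  set (up := fun p => if Rlt_dec 0 (snd (w p)) then true else false).
  assert (Hup : forall p, up p = true <-> 0 < snd (w p)).
  { intros p; unfold up; destruct (Rlt_dec 0 (snd (w p))); intuition discriminate. }
  destruct (sorted_permutation (fun p => fst (w p) / snd (w p)) (filter up P))
    as (A & Hperm & Hs).
  assert (HAin : forall p, In p A <-> In p P /\ 0 < snd (w p)).
  { intros p; rewrite <- Hup, <- filter_In; split; apply Permutation_in; auto.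
    now symmetry. }
  set (B := filter (fun p => negb (up p)) P).
  assert (Hl : (length A + length B = length P)%nat).
  { rewrite <- (Permutation_length Hperm); apply filter_length. }
  (* The horizontal line leaves only pairs with one normal strictly up and one strictly down, which
     go to the bipartite graph. *)
  destruct (half_planes_graph P w (0, 1) P Hw) as (S1 & HS1 & Hj1);
    [intros H; injection H; lra|apply incl_refl|].
  destruct (bipartite_graph P w D A B Hw) as (S2 & HS2 & Hj2); auto.
  { intros p Hp; now apply HAin. }
  { intros p Hp; now apply filter_In in Hp. }
  { lia. }
  { intros p Hp; now apply HAin. }
  exists (S1 ++ S2); split; [rewrite length_app; rewrite Hl in HS2; lia|].
  assert (Hdot : forall p, dot (0, 1) p = snd p) by (intros p; unfold dot; simpl; ring).
  assert (HAB : forall u v, In u P -> In v P -> u <> v ->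
            0 < snd (w u) -> snd (w v) < 0 -> joined P (S1 ++ S2) u v).
  { intros u v Hu Hv Hne Hu' Hv'.
    apply joined_incl with S2; [apply incl_appr, incl_refl|].
    apply Hj2; auto; [now apply HAin|].
    apply filter_In; split; [exact Hv|].
    destruct (up v) eqn:E; [apply Hup in E; lra|reflexivity]. }
  intros u v Hu Hv Hne.
  destruct (Rle_dec 0 (snd (w u) * snd (w v))) as [Hsame|Hopp].
  - apply joined_incl with S1; [apply incl_appl, incl_refl|].
    apply Hj1; auto; now rewrite !Hdot.
  - destruct (Rlt_dec 0 (snd (w u))) as [Hpos|Hneg].
    + apply HAB; auto; nra.
    + assert (Hu0 : snd (w u) <> 0) by (intros H; rewrite H in Hopp; lra).
      apply joined_sym, HAB; auto; nra.
Qed.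

(** The edge list may contain loops and repetitions; since a [link] has distinct ends in [P],
    discarding the rest preserves every chain. *)
Lemma increasing_chord_graph P w D :
  supports P w -> (length P < 2 ^ D)%nat ->
  exists S : list (point * point),
    NoDup S /\ geometric_graph P S /\ increasing_chord P S /\
    (length S <= 8 * (D + 1) * length P)%nat.
Proof.
  intros Hw HD.
  destruct (joined_graph P w D Hw HD) as (S & HS & Hj).
  assert (Hdec : forall x y : point * point, {x = y} + {x <> y}).
  { intros x y; apply excluded_middle_informative. }
  set (good := fun x : point * point =>
    if excluded_middle_informative (In (fst x) P /\ In (snd x) P /\ fst x <> snd x)
    then true else false).
  assert (Hin : forall p q, In (p, q) (nodup Hdec (filter good S)) <->
            In (p, q) S /\ In p P /\ In q P /\ p <> q).
  { intros p q; rewrite nodup_In, filter_In; unfold good; simpl.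
    destruct (excluded_middle_informative _); intuition discriminate. }
  exists (nodup Hdec (filter good S)); repeat split.
  - apply NoDup_nodup.
  - now apply Hin in H.
  - now apply Hin in H.
  - now apply Hin in H.
  - intros u v Hu Hv Hne; apply joined_path; [exact Hu|].
    destruct (Hj u v Hu Hv Hne) as (e & He & Hc); exists e; split; [exact He|].
    clear - Hc Hin.
    induction Hc as [p q (Hp & Hq & Hpq & Hed & Hst)| |]; [|apply rt_refl|eapply rt_trans; eauto].
    apply rt_step; repeat split; auto; try apply Hst.
    destruct Hed; [left|right]; apply Hin; auto.
  - apply Nat.le_trans with (length (filter good S)).
    + apply NoDup_incl_length; [apply NoDup_nodup|intros x; apply nodup_In].
    + pose proof (filter_length_le good S); lia.
Qed.

Lemma log2_le_ln (n : nat) : (0 < n)%nat -> INR (Nat.log2 n) * ln 2 <= ln (INR n).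
Proof.
  intros Hn; rewrite <- ln_pow by lra.
  assert (H : INR (2 ^ Nat.log2 n) <= INR n) by (apply le_INR, Nat.log2_spec; lia).
  rewrite pow_INR in H; replace (INR 2) with 2 in H by (simpl; lra).
  destruct H as [H|H]; [left; apply ln_increasing; [apply pow_lt; lra|exact H]|].
  rewrite H; apply Rle_refl.
Qed.

(* |S| in O(n log n): one constant C works for all convex point sets. *)
Theorem theorem2 :
  exists C : R, 0 < C /\
    forall P : list point, convex_point_set P ->
      exists S : list (point * point),
        NoDup S /\ geometric_graph P S /\ increasing_chord P S /\
        INR (length S) <= C * INR (length P) * ln (INR (length P)).
Proof.
  assert (Hln : 0 < ln 2) by (rewrite <- ln_1; apply ln_increasing; lra).
  (* For [k = Nat.log2 n] with [k >= 1], the bound [8 * (k + 2) * n] is at most [24 * k * n], and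
     [k <= ln n / ln 2]. *)
  exists (24 / ln 2); split; [apply Rdiv_lt_0_compat; lra|].
  intros P HP.
  (* For at most one point the claimed bound is 0, and the empty edge set meets it. *)
  destruct (Nat.le_gt_cases (length P) 1) as [Hsmall|Hlarge].
  { exists []; split; [constructor|split; [intros p q []|split]].
    - intros u v Hu Hv Hne; destruct P as [|p [|q P]]; simpl in *; try lia; try tauto.
      destruct Hu as [<-|[]], Hv as [<-|[]]; now elim Hne.
    - replace (24 / ln 2 * INR (length P) * ln (INR (length P))) with 0; [simpl; lra|].
      destruct P as [|p [|q P]]; simpl in *; try lia; [ring|rewrite ln_1; ring]. }
  destruct (supports_exist P HP) as (w & Hw).
  set (k := Nat.log2 (length P)).
  destruct (increasing_chord_graph P w (S k) Hw) as (G & H1 & H2 & H3 & H4).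
  { apply Nat.log2_spec; lia. }
  exists G; repeat (split; [assumption|]).
  assert (Hk : (1 <= k)%nat) by (apply Nat.log2_le_pow2; simpl; lia).
  assert (HG : (length G <= 24 * (k * length P))%nat) by nia.
  apply le_INR in HG; rewrite !mult_INR in HG.
  pose proof (log2_le_ln (length P) ltac:(lia)) as Hlog; fold k in Hlog.
  pose proof (pos_INR (length P)) as Hn.
  replace (24 / ln 2 * INR (length P) * ln (INR (length P)))
    with (24 * INR (length P) * (ln (INR (length P)) / ln 2)) by (field; lra).
  assert (Hlog' : INR k <= ln (INR (length P)) / ln 2).
  { apply Rmult_le_reg_r with (ln 2); [exact Hln|].
    replace (ln (INR (length P)) / ln 2 * ln 2) with (ln (INR (length P))) by (field; lra).
    exact Hlog. }
  replace (INR 24) with 24 in HG by (simpl; lra); nra.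
Qed.
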